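(* (1) There is an algorithm which, given a $\delta$-name $f_\gamma$ of a non-negative real number $\gamma$, computes $\delta$-names $f_\alpha$ of a non-negative real $\alpha$ and $f_\beta$ of a non-negative real $\beta$ with $\alpha+\beta=\gamma$ such that there are infinitely many $t$ with $f_\alpha^{-1}\{1,\ldots,t\}\subseteq\{0,\ldots,t-1\}$ and infinitely many $t$ with $f_\beta^{-1}\{1,\ldots,t\}\subseteq\{0,\ldots,t-1\}$; moreover, if $f_\gamma$ is a $(\delta,n)$-name, then $f_\alpha$ and $f_\beta$ are $(\delta,n)$-names. (2) For every $n$ and every $n$-strongly c.e. real $\gamma$ there exist $n$-strongly c.e. reals $\alpha$ and $\beta$ with $\alpha+\beta=\gamma$ that are additionally regainingly approximable. (3) For every regular real $\gamma$ there exist regular reals $\alpha$ and $\beta$ with $\alpha+\beta=\gamma$ that are additionally regainingly approximable.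
   Context: For $f\colon\mathbb{N}\to\mathbb{N}$ and $S\subseteq\mathbb{N}$ write $f^{-1}S:=\{i\in\mathbb{N}: f(i)\in S\}$. A function $f\colon\mathbb{N}\to\mathbb{N}$ is a $\delta$-name of a non-negative real $\alpha$ if $\sum_k a_k=\alpha$ where $a_k:=2^{-f(k)}$ if $f(k)>0$ and $a_k:=0$ if $f(k)=0$; it is a $(\delta,n)$-name if moreover $|f^{-1}\{i+1\}|\le n$ for all $i$. A real $x\in[0,1]$ is strongly left-computable if $x=\sum_{a\in A}2^{-(a+1)}$ for some computably enumerable $A\subseteq\mathbb{N}$. A real is $n$-strongly c.e. if it is the sum of $n$ strongly left-computable reals, and regular if it is $n$-strongly c.e. for some $n\in\mathbb{N}$. A real number $\alpha$ is regainingly approximable if there exists a computable nondecreasing sequence of rational numbers $(a_n)_n$ converging to $\alpha$ with $\alpha-a_n<2^{-n}$ for infinitely many $n$. *)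

(* Defs.v *)
From Stdlib Require Import Reals QArith Qreals List.
From Stdlib Require Import Ensembles Finite_sets ClassicalEpsilon.
From Stdlib Require Fin Vector.
From Coquelicot Require Import Coquelicot.

Open Scope R_scope.

(** [prog O n] is the type of mu-recursive programs of arity [n] that may query
    one oracle [nat -> nat] for each element of [O]. Taking [O] empty gives the
    ordinary mu-recursive programs; with [O := unit] the programs have access
    to one function, i.e. they compute on infinite inputs. *)
Inductive prog (O : Type) : nat -> Type :=
| Zero : prog O 0
| Succ : prog O 1
| Proj : forall n, Fin.t n -> prog O n
| Query : O -> prog O 1
| Comp : forall m n, prog O m -> (Fin.t m -> prog O n) -> prog O n
| PrimRec : forall n, prog O n -> prog O (S (S n)) -> prog O (S n)
| Mu : forall n, prog O (S n) -> prog O n.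

Arguments Zero {O}.
Arguments Succ {O}.
Arguments Proj {O n} i.
Arguments Query {O} o.
Arguments Comp {O m n} p qs.
Arguments PrimRec {O n} p q.
Arguments Mu {O n} p.

(** The graph of the function [h] with [h (0, v) = F v] and
    [h (x + 1, v) = G (x, h (x, v), v)], for partial [F] and [G]. *)
Fixpoint prim_rec_graph {n : nat} (F : Vector.t nat n -> nat -> Prop)
    (G : Vector.t nat (S (S n)) -> nat -> Prop)
    (x : nat) (v : Vector.t nat n) (y : nat) : Prop :=
  match x with
  | 0%nat => F v y
  | S x' => exists z : nat, prim_rec_graph F G x' v z /\
      G (Vector.cons nat x' (S n) (Vector.cons nat z n v)) y
  end.

(** [eval ora p v y]: with oracles [ora], program [p] halts on input [v] with
    output [y]. *)
Fixpoint eval {O : Type} (ora : O -> nat -> nat) {n : nat} (p : prog O n) :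
    Vector.t nat n -> nat -> Prop :=
  match p in prog _ n return Vector.t nat n -> nat -> Prop with
  | @Zero _ => fun _ y => y = 0%nat
  | @Succ _ => fun v y => y = S (Vector.hd v)
  | @Proj _ _ i => fun v y => y = Vector.nth v i
  | @Query _ o => fun v y => y = ora o (Vector.hd v)
  | @Comp _ m _ p qs => fun v y => exists w : Vector.t nat m,
      (forall i : Fin.t m, eval ora (qs i) v (Vector.nth w i)) /\ eval ora p w y
  | @PrimRec _ _ p q => fun v y =>
      prim_rec_graph (eval ora p) (eval ora q) (Vector.hd v) (Vector.tl v) y
  | @Mu _ n p => fun v y =>
      eval ora p (Vector.cons nat y n v) 0%nat /\
      forall z : nat, (z < y)%nat ->
        exists k : nat, eval ora p (Vector.cons nat z n v) (S k)
  end.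

Definition computes {O : Type} (ora : O -> nat -> nat) (p : prog O 1)
    (f : nat -> nat) : Prop :=
  forall k : nat, eval ora p (Vector.cons nat k 0 (Vector.nil nat)) (f k).

Definition computable (f : nat -> nat) : Prop :=
  exists p : prog Datatypes.Empty_set 1,
    computes (fun o : Datatypes.Empty_set => match o with end) p f.

Definition computes_from (p : prog unit 1) (f g : nat -> nat) : Prop :=
  computes (fun _ : unit => f) p g.

Definition comp_enumerable (A : Ensemble nat) : Prop :=
  (forall a : nat, ~ Ensembles.In nat A a) \/
  exists f : nat -> nat, computable f /\
    forall a : nat, Ensembles.In nat A a <-> exists k : nat, f k = a.

Definition computable_Qseq (a : nat -> Q) : Prop :=
  exists p q r : nat -> nat, computable p /\ computable q /\ computable r /\
    forall n : nat,
      (a n == (Z.of_nat (p n) - Z.of_nat (q n)) # Pos.of_succ_nat (r n))%Q.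

Definition preimage (f : nat -> nat) (T : Ensemble nat) : Ensemble nat :=
  fun i => Ensembles.In nat T (f i).

Definition card_at_most (A : Ensemble nat) (n : nat) : Prop :=
  exists m : nat, cardinal nat A m /\ (m <= n)%nat.

Definition name_term (f : nat -> nat) (k : nat) : R :=
  match f k with
  | 0%nat => 0
  | S _ => (/ 2) ^ (f k)
  end.

Definition delta_name (f : nat -> nat) (alpha : R) : Prop :=
  0 <= alpha /\ is_series (name_term f) alpha.

Definition delta_n_name (n : nat) (f : nat -> nat) (alpha : R) : Prop :=
  delta_name f alpha /\
  forall i : nat, card_at_most (preimage f (Singleton nat (S i))) n.

Definition complete_up_to (f : nat -> nat) (t : nat) : Prop :=
  Included nat (preimage f (fun j => (1 <= j <= t)%nat)) (fun k => (k < t)%nat).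

Definition infinitely_many (P : nat -> Prop) : Prop :=
  forall N : nat, exists t : nat, (N <= t)%nat /\ P t.

Definition set_term (A : Ensemble nat) (a : nat) : R :=
  if excluded_middle_informative (Ensembles.In nat A a)
  then (/ 2) ^ (a + 1) else 0.

Definition strongly_left_computable (x : R) : Prop :=
  0 <= x <= 1 /\
  exists A : Ensemble nat, comp_enumerable A /\ is_series (set_term A) x.

Definition n_strongly_ce (n : nat) (x : R) : Prop :=
  exists l : list R, length l = n /\ List.Forall strongly_left_computable l /\
    x = fold_right Rplus 0 l.

Definition regular (x : R) : Prop := exists n : nat, n_strongly_ce n x.

Definition regainingly_approximable (alpha : R) : Prop :=
  exists a : nat -> Q,
    computable_Qseq a /\
    (forall n : nat, (a n <= a (S n))%Q) /\
    is_lim_seq (fun n => Q2R (a n)) alpha /\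
    infinitely_many (fun n => alpha - Q2R (a n) < (/ 2) ^ n).

(* Main.v *)
(** Markers [m_0 < m_1 < ...] are maintained along the enumeration of a name
    [f]; a value [x] enumerated at stage [k] goes to the part that the least
    marker [m_i >= x] does not protect, even markers protecting one part and odd
    markers the other, and every marker beyond [m_i] is raised above [k]. Since
    every value occurs only finitely often, each marker reaches a final value
    [t], and from stage [t] on no value [<= t] enters the part it protects. The
    markers at stage [k] are the iterates of
    [m |-> max (m + 1, 1 + last j < k with 1 <= f j <= m)], so no state has to be
    carried from stage to stage.

    A computable name attaining each value at most [n] times splits, by taking
    first occurrences [n] times, into [n] injective names, that is, c.e. sets;
    conversely [n] c.e. sets are merged by interleaving. If such a name is complete
    up to [t], then its tail from [t] on is at most [n 2^-t < 2^-(t - n)], so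
    the partial sums shifted by [n] regain infinitely often. *)

Require Import Defs.
From Stdlib Require Import Reals QArith Qreals List Wf_nat Lia Lra.
From Stdlib Require Import Ensembles Finite_sets Finite_sets_facts ClassicalEpsilon.
From Stdlib Require Fin Vector.
From Coquelicot Require Import Coquelicot.
Import ListNotations.
Open Scope R_scope.

(** ** The splitting functional *)

Section Splitting.
Local Open Scope nat_scope.

(** One more than the last [j < k] with [1 <= f j <= m], or [0] if there is
    none. *)
Definition last_hit (f : nat -> nat) (k m : nat) : nat :=
  nat_rect (fun _ => nat) 0
    (fun j z => if f j =? 0 then z else if f j <=? m then S j else z) k.

Definition marker (f : nat -> nat) (k i : nat) : nat :=
  nat_rect (fun _ => nat) 0 (fun _ m => Nat.max (S m) (last_hit f k m)) i.

(** Serves as bounded minimisation: if [P] holds exactly on an initial segment reaching at most to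
    [n], the count is the least index at which [P] fails. *)
Definition count (P : nat -> bool) (n : nat) : nat :=
  nat_rect (fun _ => nat) 0 (fun i z => if P i then S z else z) n.

(** The least [i] with [f k <= marker f k i]. *)
Definition rank (f : nat -> nat) (k : nat) : nat :=
  count (fun i => marker f k i <? f k) (f k).

(** A value denied to a part is replaced by [0], which contributes nothing to the sum, so stages
    keep their numbering. Part [true] receives the values of even rank. *)
Definition part (b : bool) (f : nat -> nat) (k : nat) : nat :=
  if Bool.eqb b (Nat.even (rank f k)) then f k else 0.

(** Induction on the bound [J]: either stage [J] is itself a hit, hence the last one and [l = S J],
    or the bound can be lowered to [J]. *)
Lemma last_hit_eventually (f : nat -> nat) (m J : nat) :
  (forall j, J <= j -> f j = 0 \/ m < f j) ->
  exists l, (forall j, l <= j -> f j = 0 \/ m < f j) /\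
            (forall k, l <= k -> last_hit f k m = l).
Proof.
  induction J as [|J IH]; intros HJ.
  - exists 0. split; [exact HJ|].
    intros k _. unfold last_hit. induction k as [|k IHk]; simpl; [reflexivity|].
    destruct (HJ k) as [H|H]; [lia| |].
    + rewrite H. exact IHk.
    + destruct (Nat.eqb_spec (f k) 0); [exact IHk|].
      destruct (Nat.leb_spec (f k) m); [lia|exact IHk].
  - destruct (Nat.eq_dec (f J) 0) as [H0|H0];
      [|destruct (Nat.le_gt_cases (f J) m) as [Hm|Hm]].
    + apply IH. intros j Hj. destruct (Nat.eq_dec j J) as [->|]; [auto|].
      apply HJ; lia.
    + exists (S J). split; [exact HJ|].
      intros k Hk. induction Hk as [|k Hk IHk]; unfold last_hit in *; simpl.
      * destruct (Nat.eqb_spec (f J) 0); [lia|].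
        destruct (Nat.leb_spec (f J) m); lia.
      * destruct (HJ k) as [H|H]; [lia| |].
        -- rewrite H. exact IHk.
        -- destruct (Nat.eqb_spec (f k) 0); [exact IHk|].
           destruct (Nat.leb_spec (f k) m); [lia|exact IHk].
    + apply IH. intros j Hj. destruct (Nat.eq_dec j J) as [->|]; [auto|].
      apply HJ; lia.
Qed.

Lemma marker_S (f : nat -> nat) (k i : nat) :
  marker f k (S i) =
    Nat.max (S (marker f k i)) (last_hit f k (marker f k i)).
Proof. reflexivity. Qed.

Lemma marker_lt (f : nat -> nat) (k i j : nat) :
  i < j -> marker f k i < marker f k j.
Proof.
  induction 1 as [|j _ IH]; rewrite marker_S; lia.
Qed.

Lemma marker_le (f : nat -> nat) (k i j : nat) :
  i <= j -> marker f k i <= marker f k j.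
Proof.
  intros H. destruct (Nat.eq_dec i j) as [->|]; [lia|].
  apply Nat.lt_le_incl, marker_lt. lia.
Qed.

Lemma marker_ge (f : nat -> nat) (k i : nat) : i <= marker f k i.
Proof. induction i as [|i IH]; [lia|]. rewrite marker_S. lia. Qed.

Lemma count_below (P : nat -> bool) (i n : nat) :
  (forall j, j < i -> P j = true) -> (forall j, i <= j -> P j = false) ->
  i <= n -> count P n = i.
Proof.
  intros H1 H2 Hn.
  assert (H : forall n, count P n = Nat.min i n).
  { clear n Hn. induction n as [|n IH]; unfold count in *; simpl; [lia|].
    destruct (Nat.lt_ge_cases n i).
    - rewrite H1 by assumption. lia.
    - rewrite H2 by assumption. lia. }
  rewrite H. lia.
Qed.

(** Each positive value occurs only finitely often; [0] is exempt because it marks an absent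
    term. *)
Definition finite_to_one (f : nat -> nat) : Prop :=
  forall m, exists J, forall j, J <= j -> f j = 0 \/ m < f j.

(* The value [t] of the i-th marker is final from stage [t] on, because
   [marker f k (S i)] exceeds all stages at which the i-th marker is hit. *)
Lemma marker_final (f : nat -> nat) (i : nat) : finite_to_one f ->
  exists t, i <= t /\ forall k, t <= k ->
    marker f k i = t /\ (f k = 0 \/ forall j, j < i -> marker f k j < f k).
Proof.
  intros Hf. induction i as [|i (t & Hit & Ht)].
  - exists 0. split; [lia|]. intros k _. split; [reflexivity|]. right. lia.
  - destruct (Hf t) as [J HJ].
    destruct (last_hit_eventually f t J HJ) as (l & Hl1 & Hl2).
    exists (Nat.max (S t) l). split; [lia|]. intros k Hk.
    destruct (Ht k) as [E Hi]; [lia|]. split.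
    + rewrite marker_S, E, Hl2 by lia. reflexivity.
    (* From stage [l] on, every positive value exceeds the final value [t] of marker [i], and
       therefore all markers up to [i]. *)
    + destruct (Hl1 k) as [H|H]; [lia|auto|]. right. intros j Hj.
      apply Nat.le_lt_trans with (marker f k i); [apply marker_le; lia|lia].
Qed.

Lemma rank_eq (f : nat -> nat) (k i : nat) :
  (forall j, j < i -> marker f k j < f k) -> f k <= marker f k i ->
  rank f k = i.
Proof.
  intros H1 H2. apply count_below.
  - intros j Hj. apply Nat.ltb_lt. auto.
  - intros j Hj. apply Nat.ltb_ge. pose proof (marker_le f k i j Hj). lia.
  (* The search stops at [f k]. This suffices: the marker preceding index [i] is at least [i - 1]
     and lies below [f k], so [i <= f k]. *)
  - destruct i as [|i]; [lia|]. specialize (H1 i).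
    pose proof (marker_ge f k i). lia.
Qed.

(** Let [t] be the final value of a marker whose parity protects part [b]. A positive value at most
    [t] arriving at a stage [k >= t] exceeds all earlier markers, so its rank is the index of that
    marker and it goes to the other part. *)
Lemma part_complete (b : bool) (f : nat -> nat) : finite_to_one f ->
  infinitely_many (complete_up_to (part b f)).
Proof.
  intros Hf N.
  (* Odd markers protect part [true], even ones part [false]. The index is at least [N], and a
     marker is at least its index, whence [N <= t]. *)
  destruct (marker_final f (if b then S (2 * N) else 2 * N) Hf)
    as (t & Hit & Ht).
  exists t. split; [destruct b; lia|]. intros k Hk.
  change (1 <= part b f k <= t) in Hk. change (k < t).
  destruct (Nat.lt_ge_cases k t) as [|Hkt]; [assumption|exfalso].
  destruct (Ht k Hkt) as [E Hi]. unfold part in Hk.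
  destruct (Bool.eqb b (Nat.even (rank f k))) eqn:Eb; [|lia].
  destruct Hi as [Hi|Hi]; [lia|].
  rewrite (rank_eq f k _ Hi) in Eb by lia.
  destruct b; [rewrite Nat.even_succ, Nat.odd_mul in Eb|
               rewrite Nat.even_mul in Eb]; discriminate.
Qed.
End Splitting.

(** ** Finite sets of indices *)

Lemma cardinal_list (A : Ensemble nat) (m : nat) : cardinal nat A m ->
  exists l, NoDup l /\ length l = m /\ forall x, Ensembles.In nat A x <-> List.In x l.
Proof.
  induction 1 as [|A n HA (l & Hl & Hlen & Hin) x Hx].
  - exists []. repeat split; [constructor|intros []|intros []].
  - exists (x :: l). split; [|split].
    + constructor; [|assumption]. intros H. apply Hx, Hin, H.
    + simpl. congruence.
    + intros y. split.
      * intros [z Hz|z Hz]; [right; apply Hin, Hz|left; destruct Hz; reflexivity].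
      * intros [->|H]; [right; constructor|left; apply Hin, H].
Qed.

Lemma list_cardinal (l : list nat) : NoDup l ->
  cardinal nat (fun x => List.In x l) (length l).
Proof.
  induction 1 as [|x l Hx Hl IH]; simpl.
  - replace (fun _ : nat => False) with (Empty_set nat); [constructor|].
    apply Extensionality_Ensembles. split; intros y [].
  - replace (fun y => x = y \/ List.In y l)
      with (Add nat (fun y => List.In y l) x); [constructor; assumption|].
    apply Extensionality_Ensembles. split; intros y.
    + intros [z Hz|z Hz]; [right; exact Hz|left; destruct Hz; reflexivity].
    + intros [->|H]; [right; constructor|left; exact H].
Qed.

(** Replaces an exact cardinality by a bound on duplicate-free lists, which passes to subsets and
    preimages at once. Conversely, such a bound makes [A] finite, since a list of elements of [A]
    can be extended only finitely often. *)
Lemma card_at_most_NoDup (A : Ensemble nat) (n : nat) :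
  card_at_most A n <->
  forall l, NoDup l -> (forall x, List.In x l -> Ensembles.In nat A x) ->
    (length l <= n)%nat.
Proof.
  split.
  - intros (m & Hm & Hle) l Hl Hin.
    destruct (cardinal_list A m Hm) as (l' & _ & Hlen & Hin').
    rewrite <- Hlen in Hle. eapply Nat.le_trans; [|exact Hle].
    apply NoDup_incl_length; [assumption|]. intros x Hx. apply Hin', Hin, Hx.
  - intros H.
    (* [d] bounds the number of extensions still possible; a list that admits none enumerates
       [A]. *)
    assert (G : forall d l, (n - length l <= d)%nat -> NoDup l ->
              (forall x, List.In x l -> Ensembles.In nat A x) ->
              exists l', NoDup l' /\
                forall x, List.In x l' <-> Ensembles.In nat A x).
    { induction d as [|d IH]; intros l Hd Hl Hin;
        (destruct (excluded_middle_informative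
          (exists x, Ensembles.In nat A x /\ ~ List.In x l)) as [(x & Hx & Hxl)|Hno];
         [|exists l; split; [assumption|]; intros x; split; [apply Hin|];
           intros Hx; destruct (in_dec Nat.eq_dec x l); [assumption|];
           exfalso; apply Hno; exists x; auto]).
      - assert (length (x :: l) <= n)%nat; [|simpl in *; lia].
        apply H; [constructor; assumption|]. intros y [->|Hy]; auto.
      - assert (length (x :: l) <= n)%nat.
        { apply H; [constructor; assumption|]. intros y [->|Hy]; auto. }
        apply (IH (x :: l)); [simpl in *; lia|constructor; assumption|].
        intros y [->|Hy]; auto. }
    destruct (G n []) as (l & Hl & Hin); [simpl; lia|constructor|intros x []|].
    exists (length l). split; [|apply H; [assumption|apply Hin]].
    replace A with (fun x => List.In x l); [apply list_cardinal, Hl|].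
    apply Extensionality_Ensembles. split; intros x; apply Hin.
Qed.

(** The second clause of [delta_n_name], separated from the sum. *)
Definition multiplicity_le (n : nat) (f : nat -> nat) : Prop :=
  forall i : nat, card_at_most (preimage f (Singleton nat (S i))) n.

Lemma in_fiber (f : nat -> nat) (i k : nat) :
  Ensembles.In nat (preimage f (Singleton nat (S i))) k <-> f k = S i.
Proof.
  split; [intros H; inversion H; congruence|intros H]. unfold preimage, Ensembles.In.
  rewrite H. constructor.
Qed.

Lemma multiplicity_le_NoDup (n : nat) (f : nat -> nat) :
  multiplicity_le n f <->
  forall i l, NoDup l -> (forall k, List.In k l -> f k = S i) ->
    (length l <= n)%nat.
Proof.
  split.
  - intros H i l Hl Hin. apply (proj1 (card_at_most_NoDup _ n) (H i) l Hl).
    intros k Hk. apply in_fiber, Hin, Hk.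
  - intros H i. apply card_at_most_NoDup. intros l Hl Hin.
    apply (H i l Hl). intros k Hk. apply in_fiber, Hin, Hk.
Qed.

Lemma multiplicity_le_part (b : bool) (n : nat) (f : nat -> nat) :
  multiplicity_le n f -> multiplicity_le n (part b f).
Proof.
  rewrite !multiplicity_le_NoDup. intros H i l Hl Hin.
  apply (H i l Hl). intros k Hk. specialize (Hin k Hk). unfold part in Hin.
  destruct Bool.eqb; [assumption|discriminate].
Qed.

Lemma multiplicity_le_0 (f : nat -> nat) (k : nat) :
  multiplicity_le 0 f -> f k = 0%nat.
Proof.
  rewrite multiplicity_le_NoDup. intros H. destruct (f k) as [|i] eqn:E; [reflexivity|].
  specialize (H i [k]). simpl in H. exfalso.
  assert (1 <= 0)%nat; [|lia]. apply H.
  - constructor; [intros []|constructor].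
  - intros k' [<-|[]]. exact E.
Qed.

(** ** First and repeated occurrences *)

Definition seen (f : nat -> nat) (k : nat) : bool :=
  nat_rect (fun _ => bool) false (fun j z => orb z (f j =? f k)%nat) k.

Definition fresh (f : nat -> nat) (k : nat) : nat :=
  if seen f k then 0%nat else f k.

Definition stale (f : nat -> nat) (k : nat) : nat :=
  if seen f k then f k else 0%nat.

Lemma seen_spec (f : nat -> nat) (k : nat) :
  seen f k = true <-> exists j, (j < k)%nat /\ f j = f k.
Proof.
  unfold seen. generalize (f k) as v. intros v.
  induction k as [|k IH]; simpl.
  - split; [discriminate|intros (j & Hj & _); lia].
  - rewrite Bool.orb_true_iff, IH, Nat.eqb_eq. split.
    + intros [(j & Hj & E)|E]; [exists j|exists k]; auto with arith.
    + intros (j & Hj & E). destruct (Nat.eq_dec j k) as [->|]; [auto|].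
      left. exists j. split; [lia|assumption].
Qed.

(** Injectivity away from the padding value [0]: such a name lists a set without repetition. *)
Definition injective_name (f : nat -> nat) : Prop :=
  forall j k, f j = f k -> f j <> 0%nat -> j = k.

Lemma fresh_injective (f : nat -> nat) : injective_name (fresh f).
Proof.
  intros j k E Hj. unfold fresh in *.
  destruct (seen f j) eqn:Sj; [lia|]. destruct (seen f k) eqn:Sk; [lia|].
  destruct (Nat.lt_trichotomy j k) as [H|[H|H]]; [|assumption|].
  - assert (seen f k = true) by (apply seen_spec; exists j; auto). congruence.
  - assert (seen f j = true) by (apply seen_spec; exists k; auto). congruence.
Qed.

Lemma first_occurrence (f : nat -> nat) (k : nat) :
  exists j, (j <= k)%nat /\ f j = f k /\ seen f j = false.
Proof.
  induction k as [k IH] using (well_founded_induction lt_wf).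
  destruct (seen f k) eqn:E; [|exists k; auto].
  apply seen_spec in E as (j & Hj & E).
  destruct (IH j Hj) as (i & Hi & Ei & Si). exists i. repeat split; [lia|congruence|assumption].
Qed.

Lemma fresh_range (f : nat -> nat) (a : nat) :
  (exists k, fresh f k = S a) <-> exists k, f k = S a.
Proof.
  split; intros [k Hk].
  - exists k. unfold fresh in Hk. destruct (seen f k); [discriminate|assumption].
  - destruct (first_occurrence f k) as (j & _ & E & Sj). exists j.
    unfold fresh. rewrite Sj. congruence.
Qed.

(** The first occurrence of a value is never stale, so adding it to a list of stale occurrences of
    that value gives a longer duplicate-free list in the same fibre of [f]. *)
Lemma stale_multiplicity (n : nat) (f : nat -> nat) :
  multiplicity_le (S n) f -> multiplicity_le n (stale f).
Proof.
  rewrite !multiplicity_le_NoDup. intros H i l Hl Hin.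
  destruct l as [|k l']; [simpl; lia|].
  assert (Hk : forall x, List.In x (k :: l') -> seen f x = true /\ f x = S i).
  { intros x Hx. specialize (Hin x Hx). unfold stale in Hin.
    destruct (seen f x); [auto|discriminate]. }
  destruct (first_occurrence f k) as (j & _ & E & Sj).
  assert (length (j :: k :: l') <= S n)%nat; [|simpl in *; lia].
  apply (H i).
  - constructor; [|assumption]. intros Hj. apply Hk in Hj as [Hj _]. congruence.
  - intros x [<-|Hx]; [rewrite E; apply Hk; left; reflexivity|apply Hk, Hx].
Qed.

(** ** Interleaving *)

Definition interleave (f g : nat -> nat) (k : nat) : nat :=
  if Nat.even k then f (Nat.div2 k) else g (Nat.div2 k).

Lemma injective_name_NoDup_length (f : nat -> nat) (i : nat) (l : list nat) :
  injective_name f -> NoDup l -> (forall k, List.In k l -> f k = S i) ->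
  (length l <= 1)%nat.
Proof.
  intros Hf Hl Hin. destruct l as [|a [|b l]]; simpl; try lia.
  exfalso. inversion Hl as [|? ? Ha _]; subst. apply Ha. left. symmetry.
  apply Hf; rewrite (Hin a); simpl; auto; try lia. symmetry. apply Hin; simpl; auto.
Qed.

(** A fibre is separated by parity of its indices; halving is injective on each class and maps the
    even one into a fibre of [f], the odd one into a fibre of [g]. *)
Lemma interleave_multiplicity (n : nat) (f g : nat -> nat) :
  injective_name f -> multiplicity_le n g ->
  multiplicity_le (S n) (interleave f g).
Proof.
  intros Hf. rewrite !multiplicity_le_NoDup. intros Hg i l Hl Hin.
  rewrite <- (filter_length Nat.even l).
  assert (He : (length (filter Nat.even l) <= 1)%nat).
  { rewrite <- (length_map Nat.div2).
    apply (injective_name_NoDup_length f i); [assumption| |].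
    - apply NoDup_map_NoDup_ForallPairs; [|apply NoDup_filter, Hl].
      intros a b Ha Hb E. apply filter_In in Ha as [_ Ha], Hb as [_ Hb].
      apply Nat.even_spec in Ha as [a' ->], Hb as [b' ->].
      rewrite !Nat.div2_double in E. congruence.
    - intros k Hk. apply in_map_iff in Hk as (x & <- & Hx).
      apply filter_In in Hx as [Hx Ex]. specialize (Hin x Hx).
      unfold interleave in Hin. rewrite Ex in Hin. exact Hin. }
  assert (Ho : (length (filter (fun x => negb (Nat.even x)) l) <= n)%nat).
  { rewrite <- (length_map Nat.div2). apply (Hg i).
    - apply NoDup_map_NoDup_ForallPairs; [|apply NoDup_filter, Hl].
      intros a b Ha Hb E. apply filter_In in Ha as [_ Ha], Hb as [_ Hb].
      rewrite Nat.negb_even in Ha, Hb.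
      apply Nat.odd_spec in Ha as [a' ->], Hb as [b' ->].
      rewrite !Nat.add_1_r, !Nat.div2_succ_double in E. congruence.
    - intros k Hk. apply in_map_iff in Hk as (x & <- & Hx).
      apply filter_In in Hx as [Hx Ex]. specialize (Hin x Hx).
      unfold interleave in Hin. destruct (Nat.even x); [discriminate|exact Hin]. }
  lia.
Qed.
(** ** Recursive functionals *)

(** [numerator f n / 2 ^ exponent f n] is the [n]-th partial sum of the series
    named by [f]. *)
Definition exponent (f : nat -> nat) (n : nat) : nat :=
  nat_rect (fun _ => nat) 0%nat (fun k z => (z + f k)%nat) n.

Definition numerator (f : nat -> nat) (n : nat) : nat :=
  nat_rect (fun _ => nat) 0%nat
    (fun k z => if (f k =? 0)%nat then z else (z * 2 ^ f k + 2 ^ exponent f k)%nat) n.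

Section Recursive.
Context {I O : Type} (ora : I -> O -> nat -> nat).

(** One program must serve all [i : I] uniformly. Taking [I] to be the functions and [ora] the
    identity on them expresses computable functionals; a one-point [I] with empty [O] expresses
    ordinary computability. *)
Definition recursive {n : nat} (F : I -> Vector.t nat n -> nat) : Prop :=
  exists p : prog O n, forall i v, eval (ora i) p v (F i v).

Definition recursive1 (f : I -> nat -> nat) : Prop :=
  recursive (fun i (v : Vector.t nat 1) => f i (Vector.hd v)).

Definition decidable {n : nat} (b : I -> Vector.t nat n -> bool) : Prop :=
  recursive (fun i v => Nat.b2n (b i v)).

Lemma recursive_ext {n} (F G : I -> Vector.t nat n -> nat) :
  recursive F -> (forall i v, F i v = G i v) -> recursive G.
Proof. intros [p Hp] E. exists p. intros i v. rewrite <- E. apply Hp. Qed.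

Lemma recursive_0 {n} : recursive (fun _ (_ : Vector.t nat n) => 0%nat).
Proof.
  exists (Comp Zero (fun i => Fin.case0 (fun _ => prog O n) i)). intros i v.
  exists (Vector.nil nat). split; [intros j; inversion j|reflexivity].
Qed.

Lemma recursive_S {n} (F : I -> Vector.t nat n -> nat) :
  recursive F -> recursive (fun i v => S (F i v)).
Proof.
  intros [p Hp]. exists (Comp Succ (fun _ => p)). intros i v.
  exists (Vector.cons nat (F i v) 0 (Vector.nil nat)). split; [|reflexivity].
  intros j. apply (Fin.caseS' j); [apply Hp|intros j'; inversion j'].
Qed.

Lemma recursive_const {n} (c : nat) :
  recursive (fun _ (_ : Vector.t nat n) => c).
Proof. induction c; [apply recursive_0|apply recursive_S; assumption]. Qed.

Lemma recursive_app {n} (f : I -> nat -> nat) (F : I -> Vector.t nat n -> nat) :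
  recursive1 f -> recursive F -> recursive (fun i v => f i (F i v)).
Proof.
  intros [q Hq] [p Hp]. exists (Comp q (fun _ => p)). intros i v.
  exists (Vector.cons nat (F i v) 0 (Vector.nil nat)). split; [|apply Hq].
  intros j. apply (Fin.caseS' j); [apply Hp|intros j'; inversion j'].
Qed.

Lemma recursive_hd {n} : recursive (fun _ (v : Vector.t nat (S n)) => Vector.hd v).
Proof.
  exists (Proj Fin.F1). intros i v. simpl. rewrite (Vector.eta v). reflexivity.
Qed.

Lemma recursive_tl {n} (F : I -> Vector.t nat n -> nat) : recursive F ->
  recursive (fun i (v : Vector.t nat (S n)) => F i (Vector.tl v)).
Proof.
  intros [p Hp]. exists (Comp p (fun j => Proj (Fin.FS j))). intros i v.
  exists (Vector.tl v). split; [|apply Hp]. intros j. simpl.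
  rewrite (Vector.eta v). reflexivity.
Qed.

Lemma recursive_snd {n} :
  recursive (fun _ (v : Vector.t nat (S (S n))) => Vector.hd (Vector.tl v)).
Proof. apply (recursive_tl _ recursive_hd). Qed.

Lemma recursive_tl2 {n} (F : I -> Vector.t nat n -> nat) : recursive F ->
  recursive (fun i (v : Vector.t nat (S (S n))) => F i (Vector.tl (Vector.tl v))).
Proof. intros H. apply (recursive_tl _ (recursive_tl _ H)). Qed.

(** The functions of the construction are written with [nat_rect] so that this rule applies to them
    directly. In [G], the counter and the previous value precede the parameters, as in [PrimRec]. *)
Lemma recursive_nat_rect {n} (B : I -> Vector.t nat n -> nat)
    (G : I -> nat -> nat -> Vector.t nat n -> nat)
    (X : I -> Vector.t nat n -> nat) :
  recursive B ->
  recursive (fun i (w : Vector.t nat (S (S n))) =>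
    G i (Vector.hd w) (Vector.hd (Vector.tl w)) (Vector.tl (Vector.tl w))) ->
  recursive X ->
  recursive (fun i v =>
    nat_rect (fun _ => nat) (B i v) (fun x z => G i x z v) (X i v)).
Proof.
  intros [p Hp] [q Hq] [r Hr].
  exists (Comp (PrimRec p q)
    (fun j => Fin.caseS' j (fun _ => prog O n) r (fun j' => Proj j'))).
  intros i v. exists (Vector.cons nat (X i v) n v). split.
  - intros j. apply (Fin.caseS' j); [apply Hr|intros j'; reflexivity].
  - simpl. induction (X i v) as [|x IH]; simpl; [apply Hp|].
    eexists. split; [exact IH|].
    apply (Hq i (Vector.cons nat x (S n) (Vector.cons nat _ n v))).
Qed.

Lemma recursive_pred {n} (F : I -> Vector.t nat n -> nat) :
  recursive F -> recursive (fun i v => Nat.pred (F i v)).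
Proof.
  intros HF.
  apply recursive_ext with
    (fun i v => nat_rect (fun _ => nat) 0%nat (fun x _ => x) (F i v)).
  - apply recursive_nat_rect; [apply recursive_0|apply recursive_hd|assumption].
  - intros i v. destruct (F i v); reflexivity.
Qed.

Lemma recursive_add {n} (F G : I -> Vector.t nat n -> nat) :
  recursive F -> recursive G -> recursive (fun i v => (F i v + G i v)%nat).
Proof.
  intros HF HG. apply recursive_ext with
    (fun i v => nat_rect (fun _ => nat) (F i v) (fun _ z => S z) (G i v)).
  - apply recursive_nat_rect; [assumption|apply recursive_S, recursive_snd|assumption].
  - intros i v. induction (G i v); simpl; lia.
Qed.

Lemma recursive_sub {n} (F G : I -> Vector.t nat n -> nat) :
  recursive F -> recursive G -> recursive (fun i v => (F i v - G i v)%nat).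
Proof.
  intros HF HG. apply recursive_ext with
    (fun i v => nat_rect (fun _ => nat) (F i v) (fun _ z => Nat.pred z) (G i v)).
  - apply recursive_nat_rect; [assumption|apply recursive_pred, recursive_snd|assumption].
  - intros i v. induction (G i v); simpl; lia.
Qed.

Lemma recursive_mul {n} (F G : I -> Vector.t nat n -> nat) :
  recursive F -> recursive G -> recursive (fun i v => (F i v * G i v)%nat).
Proof.
  intros HF HG. apply recursive_ext with
    (fun i v => nat_rect (fun _ => nat) 0%nat (fun _ z => (z + F i v)%nat) (G i v)).
  - apply recursive_nat_rect; [apply recursive_0| |assumption].
    apply recursive_add; [apply recursive_snd|apply recursive_tl2, HF].
  - intros i v. induction (G i v); simpl; lia.
Qed.

Lemma recursive_pow2 {n} (F : I -> Vector.t nat n -> nat) :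
  recursive F -> recursive (fun i v => (2 ^ F i v)%nat).
Proof.
  intros HF. apply recursive_ext with
    (fun i v => nat_rect (fun _ => nat) 1%nat (fun _ z => (z + z)%nat) (F i v)).
  - apply recursive_nat_rect; [apply recursive_const| |assumption].
    apply recursive_add; apply recursive_snd.
  - intros i v. induction (F i v); simpl; lia.
Qed.

Lemma decidable_leb {n} (F G : I -> Vector.t nat n -> nat) :
  recursive F -> recursive G -> decidable (fun i v => (F i v <=? G i v)%nat).
Proof.
  intros HF HG.
  apply recursive_ext with (fun i v => (1 - (F i v - G i v))%nat).
  - apply recursive_sub; [apply recursive_const|apply recursive_sub; assumption].
  - intros i v. destruct (Nat.leb_spec (F i v) (G i v)); simpl Nat.b2n; lia.
Qed.

Lemma decidable_ltb {n} (F G : I -> Vector.t nat n -> nat) :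
  recursive F -> recursive G -> decidable (fun i v => (F i v <? G i v)%nat).
Proof. intros HF HG. apply decidable_leb; [apply recursive_S|]; assumption. Qed.

(** A case distinction is a recursion of length [0] or [1] that ignores its previous value. *)
Lemma recursive_if {n} (b : I -> Vector.t nat n -> bool)
    (F G : I -> Vector.t nat n -> nat) :
  decidable b -> recursive F -> recursive G ->
  recursive (fun i v => if b i v then F i v else G i v).
Proof.
  intros Hb HF HG. apply recursive_ext with (fun i v =>
    nat_rect (fun _ => nat) (G i v) (fun _ _ => F i v) (Nat.b2n (b i v))).
  - apply recursive_nat_rect; [assumption|apply recursive_tl2, HF|exact Hb].
  - intros i v. destruct (b i v); reflexivity.
Qed.

Lemma recursive_max {n} (F G : I -> Vector.t nat n -> nat) :
  recursive F -> recursive G -> recursive (fun i v => Nat.max (F i v) (G i v)).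
Proof.
  intros HF HG. apply recursive_ext with (fun i v => (F i v + (G i v - F i v))%nat).
  - apply recursive_add; [|apply recursive_sub]; assumption.
  - intros i v. lia.
Qed.

Lemma decidable_eqb {n} (F G : I -> Vector.t nat n -> nat) :
  recursive F -> recursive G -> decidable (fun i v => (F i v =? G i v)%nat).
Proof.
  intros HF HG.
  apply recursive_ext with (fun i v => (1 - (F i v - G i v) - (G i v - F i v))%nat).
  - repeat apply recursive_sub; try assumption. apply recursive_const.
  - intros i v. destruct (Nat.eqb_spec (F i v) (G i v)); simpl Nat.b2n; lia.
Qed.

Lemma decidable_even {n} (F : I -> Vector.t nat n -> nat) :
  recursive F -> decidable (fun i v => Nat.even (F i v)).
Proof.
  intros HF. apply recursive_ext with
    (fun i v => nat_rect (fun _ => nat) 1%nat (fun _ z => (1 - z)%nat) (F i v)).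
  - apply recursive_nat_rect; [apply recursive_const| |assumption].
    apply recursive_sub; [apply recursive_const|apply recursive_snd].
  - intros i v. induction (F i v) as [|x IH]; [reflexivity|].
    rewrite Nat.even_succ, <- Nat.negb_even. cbn [nat_rect]. rewrite IH.
    destruct (Nat.even x); reflexivity.
Qed.

Lemma recursive_div2 {n} (F : I -> Vector.t nat n -> nat) :
  recursive F -> recursive (fun i v => Nat.div2 (F i v)).
Proof.
  intros HF. apply recursive_ext with (fun i v => nat_rect (fun _ => nat) 0%nat
    (fun x z => if Nat.even x then z else S z) (F i v)).
  - apply recursive_nat_rect; [apply recursive_const| |assumption].
    apply recursive_if; [apply decidable_even, recursive_hd|apply recursive_snd|].
    apply recursive_S, recursive_snd.
  - intros i v. induction (F i v) as [|x IH]; [reflexivity|].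
    cbn [nat_rect]. rewrite IH. destruct (Nat.even x) eqn:E.
    + apply Nat.even_spec in E as [y ->].
      rewrite Nat.div2_succ_double, Nat.div2_double. reflexivity.
    + assert (Nat.odd x = true) as [y ->]%Nat.odd_spec
        by (rewrite <- Nat.negb_even, E; reflexivity).
      rewrite Nat.add_1_r, Nat.div2_succ_double.
      replace (S (S (2 * y)))%nat with (2 * S y)%nat by lia.
      rewrite Nat.div2_double. reflexivity.
Qed.

(** Selects a closure rule by the shape of the function; the weakening rule [recursive_tl2], which
    leaves the function to be guessed, is tried last. *)
Ltac recursive_step :=
  cbn beta;
  match goal with
  | H : recursive ?F |- recursive ?F => exact H
  | H : recursive1 ?f |- recursive1 ?f => exact H
  | _ => apply recursive_const
  | _ => apply recursive_hd
  | _ => apply recursive_snd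
  | _ => apply recursive_S
  | _ => apply recursive_add
  | _ => apply recursive_mul
  | _ => apply recursive_max
  | _ => apply recursive_pow2
  | _ => apply recursive_div2
  | _ => apply recursive_pred
  | _ => apply decidable_ltb
  | _ => apply decidable_leb
  | _ => apply decidable_eqb
  | _ => apply decidable_even
  | _ => apply recursive_if
  | H : recursive1 ?f |- _ => apply (recursive_app f _ H)
  | _ => apply recursive_nat_rect
  | _ => apply recursive_tl2
  end.

(** * Recursiveness of the splitting, of first occurrences, of interleaving and of partial sums *)

Lemma recursive_last_hit {n} (f : I -> nat -> nat) (K M : I -> Vector.t nat n -> nat) :
  recursive1 f -> recursive K -> recursive M ->
  recursive (fun i v => last_hit (f i) (K i v) (M i v)).
Proof. intros Hf HK HM. unfold last_hit. repeat recursive_step. Qed.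

Lemma recursive_marker {n} (f : I -> nat -> nat) (K J : I -> Vector.t nat n -> nat) :
  recursive1 f -> recursive K -> recursive J ->
  recursive (fun i v => marker (f i) (K i v) (J i v)).
Proof.
  intros Hf HK HJ. unfold marker.
  apply recursive_nat_rect; [apply recursive_0| |assumption]. cbn beta.
  apply recursive_max; [repeat recursive_step|].
  apply recursive_last_hit; repeat recursive_step.
Qed.

Lemma recursive_rank {n} (f : I -> nat -> nat) (K : I -> Vector.t nat n -> nat) :
  recursive1 f -> recursive K -> recursive (fun i v => rank (f i) (K i v)).
Proof.
  intros Hf HK. unfold rank, count.
  apply recursive_nat_rect; [apply recursive_0| |repeat recursive_step]. cbn beta.
  apply recursive_if; [|repeat recursive_step ..].
  (* Inside the recursion the parameters stand behind the counter and the accumulator, so [f (K v)]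
     is weakened by two places. *)
  apply decidable_ltb; [|apply (recursive_tl2 _ (recursive_app f K Hf HK))].
  apply recursive_marker; repeat recursive_step.
Qed.

(** As [b] is fixed outside the program, only the parity of the rank has to be tested by it. *)
Lemma recursive_part (b : bool) (f : I -> nat -> nat) :
  recursive1 f -> recursive1 (fun i => part b (f i)).
Proof.
  intros Hf. apply recursive_ext with (fun i v =>
    if Nat.even (rank (f i) (Vector.hd v))
    then (if b then f i (Vector.hd v) else 0%nat)
    else (if b then 0%nat else f i (Vector.hd v))).
  - apply recursive_if; [|destruct b; repeat recursive_step ..].
    apply decidable_even, recursive_rank; repeat recursive_step.
  - intros i v. unfold part. destruct b, Nat.even; reflexivity.
Qed.

Lemma decidable_seen {n} (f : I -> nat -> nat) (K : I -> Vector.t nat n -> nat) :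
  recursive1 f -> recursive K -> decidable (fun i v => seen (f i) (K i v)).
Proof.
  intros Hf HK. apply recursive_ext with (fun i v => nat_rect (fun _ => nat) 0%nat
    (fun j z => if (f i j =? f i (K i v))%nat then 1%nat else z) (K i v)).
  - apply recursive_nat_rect; [apply recursive_0| |assumption].
    apply recursive_if; [|repeat recursive_step ..].
    apply decidable_eqb; [repeat recursive_step|].
    apply (recursive_tl2 _ (recursive_app f K Hf HK)).
  - intros i v. unfold seen. generalize (f i (K i v)) as u. intros u.
    induction (K i v) as [|k IH]; simpl; [reflexivity|]. rewrite IH.
    destruct (f i k =? u)%nat; [rewrite Bool.orb_true_r|rewrite Bool.orb_false_r];
      reflexivity.
Qed.

Lemma recursive_fresh (f : I -> nat -> nat) :
  recursive1 f -> recursive1 (fun i => fresh (f i)).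
Proof.
  intros Hf. unfold recursive1, fresh.
  apply recursive_if; [apply decidable_seen|..]; repeat recursive_step.
Qed.

Lemma recursive_stale (f : I -> nat -> nat) :
  recursive1 f -> recursive1 (fun i => stale (f i)).
Proof.
  intros Hf. unfold recursive1, stale.
  apply recursive_if; [apply decidable_seen|..]; repeat recursive_step.
Qed.

Lemma recursive_interleave (f g : I -> nat -> nat) :
  recursive1 f -> recursive1 g ->
  recursive1 (fun i => interleave (f i) (g i)).
Proof.
  intros Hf Hg. unfold recursive1, interleave.
  apply recursive_if; [repeat recursive_step|apply (recursive_app f)|
                       apply (recursive_app g)]; repeat recursive_step.
Qed.

Lemma recursive_exponent (f : I -> nat -> nat) :
  recursive1 f -> recursive1 (fun i => exponent (f i)).
Proof. intros Hf. unfold recursive1, exponent. repeat recursive_step. Qed.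

Lemma recursive_numerator (f : I -> nat -> nat) :
  recursive1 f -> recursive1 (fun i => numerator (f i)).
Proof.
  intros Hf. pose proof (recursive_exponent f Hf) as He.
  unfold recursive1, numerator. repeat recursive_step.
Qed.

End Recursive.

(** Transfers the closure rules above to computability without oracle. *)
Lemma computable_recursive (f : nat -> nat) :
  computable f <->
  recursive1 (fun (_ : unit) (o : Datatypes.Empty_set) => match o with end)
    (fun _ => f).
Proof.
  split; intros [p Hp]; exists p.
  - intros _ v. rewrite (Vector.eta v).
    apply (Vector.case0 (fun w => eval _ p (Vector.cons nat (Vector.hd v) 0 w) _)).
    apply Hp.
  - intros k. apply (Hp tt (Vector.cons nat k 0 (Vector.nil nat))).
Qed.

Lemma computable_comp (f g : nat -> nat) :
  computable f -> computable g -> computable (fun k => g (f k)).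
Proof.
  rewrite !computable_recursive. intros Hf Hg.
  apply (recursive_app _ (fun _ => g) (fun _ v => f (Vector.hd v)) Hg Hf).
Qed.

Lemma computable_S : computable S.
Proof. apply computable_recursive, recursive_S, recursive_hd. Qed.

Lemma computable_const (c : nat) : computable (fun _ => c).
Proof. apply computable_recursive, (recursive_const _ c). Qed.

(** ** Sums of names *)

(** Sums over arbitrary lists of indices, so that sums of non-negative series can be compared
    through finite index sets in any order. *)
Definition lsum (a : nat -> R) (l : list nat) : R :=
  fold_right Rplus 0 (map a l).

Lemma lsum_app (a : nat -> R) (l l' : list nat) :
  lsum a (l ++ l') = lsum a l + lsum a l'.
Proof. unfold lsum. induction l as [|x l IH]; simpl; [|rewrite IH]; ring. Qed.

Lemma lsum_nonneg (a : nat -> R) (l : list nat) :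
  (forall k, 0 <= a k) -> 0 <= lsum a l.
Proof.
  intros Ha. unfold lsum. induction l as [|x l IH]; simpl; [lra|].
  specialize (Ha x). lra.
Qed.

Lemma lsum_incl (a : nat -> R) (l l' : list nat) :
  (forall k, 0 <= a k) -> NoDup l -> incl l l' -> lsum a l <= lsum a l'.
Proof.
  intros Ha Hl. revert l'. induction Hl as [|x l Hx Hl IH]; intros l' Hin.
  - apply lsum_nonneg, Ha.
  - destruct (in_split x l') as (l1 & l2 & ->); [apply Hin; left; reflexivity|].
    assert (H : lsum a l <= lsum a (l1 ++ l2)).
    { apply IH. intros y Hy. specialize (Hin y (or_intror Hy)).
      apply in_app_iff in Hin as [H|[->|H]]; apply in_app_iff; auto. contradiction. }
    rewrite lsum_app in *. change (lsum a (x :: l)) with (a x + lsum a l).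
    change (lsum a (x :: l2)) with (a x + lsum a l2). lra.
Qed.

Lemma lsum_plus (a b c : nat -> R) (l : list nat) :
  (forall k, a k = b k + c k) -> lsum a l = lsum b l + lsum c l.
Proof.
  intros E. unfold lsum. induction l as [|x l IH]; simpl; [ring|].
  rewrite IH, E. ring.
Qed.

Lemma lsum_seq_S (a : nat -> R) (n : nat) :
  lsum a (seq 0 (S n)) = lsum a (seq 0 n) + a n.
Proof.
  rewrite seq_S, lsum_app. unfold lsum at 2. simpl. ring.
Qed.

Lemma lsum_sum_n (a : nat -> R) (n : nat) : lsum a (seq 0 (S n)) = sum_n a n.
Proof.
  induction n as [|n IH].
  - rewrite sum_O. unfold lsum. simpl. ring.
  - rewrite lsum_seq_S, IH, sum_Sn. reflexivity.
Qed.

Lemma incl_seq (l : list nat) : exists n, forall m, (n <= m)%nat -> incl l (seq 0 m).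
Proof.
  exists (S (list_max l)). intros m Hm x Hx. apply in_seq.
  assert (x <= list_max l)%nat; [|lia].
  pose proof (proj1 (list_max_le l _) (le_n _)) as H.
  rewrite Forall_forall in H. auto.
Qed.

Lemma lsum_le_series (a : nat -> R) (x : R) (l : list nat) :
  (forall k, 0 <= a k) -> is_series a x -> NoDup l -> lsum a l <= x.
Proof.
  intros Ha Hx Hl. destruct (incl_seq l) as [n Hn].
  apply Rle_trans with (sum_n a n).
  - rewrite <- lsum_sum_n. apply lsum_incl; auto.
  - apply (is_lim_seq_incr_compare (sum_n a) x Hx).
    intros k. rewrite sum_Sn. unfold plus; simpl. specialize (Ha (S k)). lra.
Qed.

Lemma series_le (a : nat -> R) (x y : R) :
  is_series a x -> (forall n, lsum a (seq 0 n) <= y) -> x <= y.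
Proof.
  intros Hx Hy. apply (is_lim_seq_le (sum_n a) (fun _ => y) x y).
  - intros n. rewrite <- lsum_sum_n. apply Hy.
  - exact Hx.
  - apply is_lim_seq_const.
Qed.

Lemma is_series_lsum (a : nat -> R) (x : R) :
  is_series a x <-> is_lim_seq (fun n => lsum a (seq 0 n)) x.
Proof.
  split; intros H.
  - apply is_lim_seq_incr_1.
    apply is_lim_seq_ext with (sum_n a); [|exact H].
    intros n. symmetry. apply lsum_sum_n.
  - apply is_lim_seq_incr_1 in H.
    change (is_lim_seq (sum_n a) x). eapply is_lim_seq_ext; [|exact H].
    intros n. apply lsum_sum_n.
Qed.

(** The sum of a non-negative series is the supremum of its finite subsums; families of finite
    subsums that dominate each other have the same supremum. *)
Lemma is_series_rearrange (a b : nat -> R) (x : R) :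
  (forall k, 0 <= a k) -> (forall k, 0 <= b k) ->
  (forall l, NoDup l -> exists l', NoDup l' /\ lsum a l <= lsum b l') ->
  (forall l, NoDup l -> exists l', NoDup l' /\ lsum b l <= lsum a l') ->
  is_series a x -> is_series b x.
Proof.
  intros Ha Hb Hab Hba Hx. apply is_series_lsum.
  apply is_lim_seq_spec. intros eps.
  apply is_series_lsum in Hx as Hlim. apply is_lim_seq_spec in Hlim.
  destruct (Hlim eps) as [N HN]. specialize (HN N (le_n N)).
  (* Lower bound: a finite subsum of [b] dominates the first [N] terms of [a], and long initial
     segments contain it. The upper bound comes from [Hba]. *)
  destruct (Hab (seq 0 N) (seq_NoDup _ _)) as (l & Hl & Hle).
  destruct (incl_seq l) as [n Hn]. exists n. intros m Hm.
  destruct (Hba (seq 0 m) (seq_NoDup _ _)) as (l' & Hl' & Hle').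
  pose proof (lsum_le_series a x l' Ha Hx Hl').
  pose proof (lsum_incl b l (seq 0 m) Hb Hl (Hn m Hm)).
  pose proof (lsum_le_series a x _ Ha Hx (seq_NoDup N 0)).
  apply Rabs_def2 in HN. apply Rabs_def1; lra.
Qed.

(** * Series given by names and by sets *)

Lemma name_term_eq (f g : nat -> nat) (j k : nat) :
  f j = g k -> name_term f j = name_term g k.
Proof. unfold name_term. intros ->. reflexivity. Qed.

Lemma name_term_0 (f : nat -> nat) (k : nat) : f k = 0%nat -> name_term f k = 0.
Proof. unfold name_term. intros ->. reflexivity. Qed.

Lemma name_term_S (f : nat -> nat) (k a : nat) :
  f k = S a -> name_term f k = (/ 2) ^ (a + 1).
Proof. unfold name_term. intros ->. rewrite Nat.add_1_r. reflexivity. Qed.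

Lemma half_pow_pos (n : nat) : 0 < (/ 2) ^ n.
Proof. apply pow_lt. lra. Qed.

Lemma name_term_nonneg (f : nat -> nat) (k : nat) : 0 <= name_term f k.
Proof.
  unfold name_term. destruct (f k); [lra|]. apply Rlt_le, half_pow_pos.
Qed.

Lemma set_term_nonneg (A : Ensemble nat) (a : nat) : 0 <= set_term A a.
Proof.
  unfold set_term. destruct excluded_middle_informative; [|lra].
  apply Rlt_le, half_pow_pos.
Qed.

(** Turns a sum over indices into one over distinct values: zero terms are dropped, and the value
    [S a] corresponds to the element [a] of weight [2^-(a+1)]. *)
Lemma injective_name_values (f : nat -> nat) (l : list nat) :
  injective_name f -> NoDup l ->
  exists l', NoDup l' /\
    lsum (name_term f) l = lsum (fun a => (/ 2) ^ (a + 1)) l' /\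
    forall a, List.In a l' -> exists k, List.In k l /\ f k = S a.
Proof.
  intros Hf Hl. induction Hl as [|k l Hk Hl (l' & Hl' & E & Hin)].
  - exists []. repeat split; [constructor|intros a []].
  - change (lsum (name_term f) (k :: l)) with (name_term f k + lsum (name_term f) l).
    destruct (f k) as [|a] eqn:Ek.
    + exists l'. split; [assumption|split].
      * rewrite name_term_0 by assumption. lra.
      * intros a Ha. destruct (Hin a Ha) as (j & Hj & Ej).
        exists j. split; [right|]; assumption.
    + exists (a :: l'). split; [|split].
      * constructor; [|assumption]. intros Ha. destruct (Hin a Ha) as (j & Hj & Ej).
        apply Hk. rewrite (Hf k j); congruence.
      * rewrite (name_term_S f k a Ek), E. reflexivity.
      * intros b [<-|Hb]; [exists k; split; [left; reflexivity|assumption]|].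
        destruct (Hin b Hb) as (j & Hj & Ej).
        exists j. split; [right|]; assumption.
Qed.

Lemma lsum_set_term (A : Ensemble nat) (l : list nat) :
  (forall a, List.In a l -> Ensembles.In nat A a) ->
  lsum (set_term A) l = lsum (fun a => (/ 2) ^ (a + 1)) l.
Proof.
  intros H. unfold lsum. f_equal. apply map_ext_in. intros a Ha.
  unfold set_term. destruct excluded_middle_informative as [|n]; [reflexivity|].
  exfalso. apply n, H, Ha.
Qed.

(** One index is chosen for each listed element of [A]; different elements get different indices
    because [f] separates them. *)
Lemma set_term_indices (f : nat -> nat) (A : Ensemble nat) (l : list nat) :
  (forall a, Ensembles.In nat A a <-> exists k, f k = S a) -> NoDup l ->
  exists l', NoDup l' /\ lsum (set_term A) l = lsum (name_term f) l' /\
    forall k, List.In k l' -> exists a, List.In a l /\ f k = S a.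
Proof.
  intros HA Hl. induction Hl as [|a l Ha Hl (l' & Hl' & E & Hin)].
  - exists []. repeat split; [constructor|intros a []].
  - change (lsum (set_term A) (a :: l)) with (set_term A a + lsum (set_term A) l).
    unfold set_term at 1. destruct excluded_middle_informative as [Aa|Aa].
    + apply HA in Aa as [k Ek]. exists (k :: l'). split; [|split].
      * constructor; [|assumption]. intros Hk. destruct (Hin k Hk) as (b & Hb & Eb).
        apply Ha. congruence.
      * rewrite <- (name_term_S f k a Ek), E. reflexivity.
      * intros j [<-|Hj]; [exists a; split; [left; reflexivity|assumption]|].
        destruct (Hin j Hj) as (b & Hb & Eb).
        exists b. split; [right|]; assumption.
    + exists l'. split; [assumption|split; [lra|]].
      intros j Hj. destruct (Hin j Hj) as (b & Hb & Eb).
      exists b. split; [right|]; assumption.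
Qed.

(** Links names to sets: the two preceding translations of finite sums supply the mutual domination
    for rearrangement. *)
Lemma name_series_set (f : nat -> nat) (A : Ensemble nat) (x : R) :
  injective_name f -> (forall a, Ensembles.In nat A a <-> exists k, f k = S a) ->
  is_series (name_term f) x <-> is_series (set_term A) x.
Proof.
  intros Hf HA.
  assert (H1 : forall l, NoDup l -> exists l', NoDup l' /\
            lsum (name_term f) l <= lsum (set_term A) l').
  { intros l Hl. destruct (injective_name_values f l Hf Hl) as (l' & Hl' & E & Hin).
    exists l'. split; [assumption|]. rewrite lsum_set_term; [lra|].
    intros a Ha. apply HA. destruct (Hin a Ha) as (k & _ & Ek). exists k. exact Ek. }
  assert (H2 : forall l, NoDup l -> exists l', NoDup l' /\
            lsum (set_term A) l <= lsum (name_term f) l').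
  { intros l Hl. destruct (set_term_indices f A l HA Hl) as (l' & Hl' & E & _).
    exists l'. split; [assumption|lra]. }
  split; apply is_series_rearrange; auto using name_term_nonneg, set_term_nonneg.
Qed.

Lemma name_series_interleave (f g : nat -> nat) (x y : R) :
  is_series (name_term f) x -> is_series (name_term g) y ->
  is_series (name_term (interleave f g)) (x + y).
Proof.
  intros Hx Hy.
  (* Initial segments of even length pair the terms of [f] and [g], and every finite index set lies
     in such a segment. *)
  assert (E : forall n, lsum (name_term (interleave f g)) (seq 0 (2 * n)) =
                        lsum (fun k => name_term f k + name_term g k) (seq 0 n)).
  { induction n as [|n IH]; [reflexivity|].
    replace (2 * S n)%nat with (S (S (2 * n))) by lia.
    rewrite !lsum_seq_S, IH.
    rewrite (name_term_eq (interleave f g) f (2 * n) n).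
    2:{ unfold interleave. rewrite Nat.even_even, Nat.div2_double. reflexivity. }
    rewrite (name_term_eq (interleave f g) g (S (2 * n)) n).
    2:{ unfold interleave. rewrite Nat.div2_succ_double, Nat.even_succ, <- Nat.negb_even.
        rewrite Nat.even_even. reflexivity. }
    ring. }
  assert (Hpos : forall k, 0 <= name_term f k + name_term g k).
  { intros k. pose proof (name_term_nonneg f k). pose proof (name_term_nonneg g k). lra. }
  apply is_series_rearrange with (fun k => name_term f k + name_term g k);
    [exact Hpos|apply name_term_nonneg| | |apply (is_series_plus _ _ x y Hx Hy)].
  - intros l Hl. destruct (incl_seq l) as [n Hn]. exists (seq 0 (2 * n)).
    split; [apply seq_NoDup|]. rewrite E. apply lsum_incl; auto.
  - intros l Hl. destruct (incl_seq l) as [n Hn]. exists (seq 0 n).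
    split; [apply seq_NoDup|]. rewrite <- E.
    apply lsum_incl; [apply name_term_nonneg|assumption|]. apply Hn. lia.
Qed.

(** Both parts converge by comparison with the series of [f], and their terms add up to its
    terms. *)
Lemma delta_name_split (f g h : nat -> nat) (x : R) :
  (forall k, (g k = f k /\ h k = 0%nat) \/ (g k = 0%nat /\ h k = f k)) ->
  delta_name f x ->
  exists y z, delta_name g y /\ delta_name h z /\ y + z = x.
Proof.
  intros H [_ Hx].
  assert (E : forall k, name_term f k = name_term g k + name_term h k).
  { intros k. destruct (H k) as [[Hg Hh]|[Hg Hh]].
    - rewrite (name_term_eq g f k k Hg), (name_term_0 h k Hh). ring.
    - rewrite (name_term_eq h f k k Hh), (name_term_0 g k Hg). ring. }
  assert (Hex : forall g, (forall k, name_term g k <= name_term f k) ->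
            exists y, delta_name g y).
  { intros g' Hg'.
    assert (ex_series (name_term g')) as [y Hy].
    { apply (ex_series_le (K := R_AbsRing) (V := R_CompleteNormedModule))
        with (name_term f); [|exists x; exact Hx].
      intros k. change (Rabs (name_term g' k) <= name_term f k).
      rewrite Rabs_pos_eq; [apply Hg'|apply name_term_nonneg]. }
    exists y. split; [|exact Hy].
    (* The empty subsum [0] is at most [y]. *)
    apply (lsum_le_series _ y [] (name_term_nonneg g') Hy). constructor. }
  destruct (Hex g) as [y Hy].
  { intros k. rewrite E. pose proof (name_term_nonneg h k). lra. }
  destruct (Hex h) as [z Hz].
  { intros k. rewrite E. pose proof (name_term_nonneg g k). lra. }
  exists y, z. split; [assumption|split; [assumption|]].
  rewrite <- (is_series_unique _ _ Hx).
  symmetry. apply is_series_unique.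
  apply is_series_ext with (fun k => name_term g k + name_term h k).
  - intros k. symmetry. apply E.
  - apply (is_series_plus _ _ y z (proj2 Hy) (proj2 Hz)).
Qed.

(** The terms of a convergent series eventually drop below [2^-m], whereas a positive value at most
    [m] would give a term of at least [2^-m]. *)
Lemma delta_name_finite_to_one (f : nat -> nat) (x : R) :
  delta_name f x -> finite_to_one f.
Proof.
  intros [_ Hx] m.
  assert (Hlim : is_lim_seq (name_term f) 0) by (apply ex_series_lim_0; exists x; exact Hx).
  apply is_lim_seq_spec in Hlim.
  destruct (Hlim (mkposreal _ (half_pow_pos m))) as [J HJ]. exists J. intros j Hj.
  specialize (HJ j Hj). simpl in HJ. rewrite Rminus_0_r in HJ.
  rewrite Rabs_pos_eq in HJ by apply name_term_nonneg.
  destruct (f j) as [|a] eqn:E; [auto|right].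
  destruct (Nat.lt_ge_cases m (S a)) as [|Ha]; [assumption|exfalso].
  rewrite (name_term_S f j a E) in HJ. revert HJ. apply Rle_not_lt.
  replace m with (a + 1 + (m - S a))%nat by lia. rewrite (pow_add _ (a + 1)).
  pose proof (half_pow_pos (a + 1)).
  assert ((/ 2) ^ (m - S a) <= 1); [|nra].
  rewrite <- (pow1 (m - S a)). apply pow_incr. lra.
Qed.

(** * Tail estimates for complete names *)

Lemma geometric_tail (t m : nat) :
  lsum (fun a => (/ 2) ^ (a + 1)) (seq t m) <= (/ 2) ^ t.
Proof.
  assert (H : lsum (fun a => (/ 2) ^ (a + 1)) (seq t m) = (/ 2) ^ t - (/ 2) ^ (t + m)).
  { revert t. induction m as [|m IH]; intros t.
    - rewrite Nat.add_0_r. unfold lsum. simpl. ring.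
    - simpl seq.
      change (lsum (fun a => (/ 2) ^ (a + 1)) (t :: seq (S t) m))
        with ((/ 2) ^ (t + 1) + lsum (fun a => (/ 2) ^ (a + 1)) (seq (S t) m)).
      rewrite IH, Nat.add_1_r. replace (S t + m)%nat with (t + S m)%nat by lia.
      simpl. lra. }
  rewrite H. pose proof (half_pow_pos (t + m)). lra.
Qed.

(** From index [t] on only [0] and values above [t] occur, each positive one at most once, so the
    tail is bounded by the sum of [2^-v] over [v > t], which is [2^-t]. *)
Lemma injective_name_tail (f : nat -> nat) (x : R) (t : nat) :
  injective_name f -> complete_up_to f t -> is_series (name_term f) x ->
  x <= lsum (name_term f) (seq 0 t) + (/ 2) ^ t.
Proof.
  intros Hf Ht Hx. apply (series_le _ _ _ Hx). intros n.
  apply Rle_trans with (lsum (name_term f) (seq 0 (t + n))).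
  { apply lsum_incl; [apply name_term_nonneg|apply seq_NoDup|].
    intros k Hk. apply in_seq in Hk. apply in_seq. lia. }
  rewrite seq_app, lsum_app. apply Rplus_le_compat_l. simpl.
  destruct (injective_name_values f (seq t n) Hf (seq_NoDup _ _))
    as (l & Hl & -> & Hin).
  destruct (incl_seq l) as [m Hm].
  apply Rle_trans with (lsum (fun a => (/ 2) ^ (a + 1)) (seq t m));
    [|apply geometric_tail].
  apply lsum_incl; [intros k; apply Rlt_le, half_pow_pos|assumption|].
  intros a Ha. pose proof (Hm m (le_n m) a Ha) as Ham. apply in_seq in Ham.
  apply in_seq. destruct (Hin a Ha) as (k & Hk & Ek). apply in_seq in Hk.
  (* If [a < t], then [f k = S a] lies between [1] and [t], and completeness forces [k < t],
     although [k] comes from the tail. *)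
  destruct (Nat.lt_ge_cases a t) as [Hat|]; [exfalso|lia].
  assert (k < t)%nat; [|lia]. apply (Ht k).
  change (1 <= f k <= t)%nat. lia.
Qed.

Lemma fresh_stale (f : nat -> nat) (k : nat) :
  (fresh f k = f k /\ stale f k = 0%nat) \/ (fresh f k = 0%nat /\ stale f k = f k).
Proof. unfold fresh, stale. destruct (seen f k); auto. Qed.

Lemma delta_n_name_stale (n : nat) (f : nat -> nat) (x : R) :
  delta_n_name (S n) f x ->
  exists y z, delta_name (fresh f) y /\ delta_n_name n (stale f) z /\ y + z = x.
Proof.
  intros [Hx Hm].
  destruct (delta_name_split f (fresh f) (stale f) x (fresh_stale f) Hx)
    as (y & z & Hy & Hz & E).
  exists y, z. split; [assumption|split; [|assumption]].
  split; [assumption|exact (stale_multiplicity n f Hm)].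
Qed.

Lemma delta_0_name_sum (f : nat -> nat) (x : R) : delta_n_name 0 f x -> x = 0.
Proof.
  intros [[_ Hx] Hm]. rewrite <- (is_series_unique _ _ Hx).
  apply is_series_unique, is_series_lsum.
  apply is_lim_seq_ext with (fun _ => 0); [|apply is_lim_seq_const].
  intros n. induction n as [|n IH]; [reflexivity|].
  rewrite lsum_seq_S, <- IH, name_term_0; [ring|].
  exact (multiplicity_le_0 f n Hm).
Qed.

Lemma complete_up_to_mono (f g : nat -> nat) (t : nat) :
  (forall k, g k = 0%nat \/ g k = f k) -> complete_up_to f t -> complete_up_to g t.
Proof.
  intros H Hf k Hk. apply Hf. change (1 <= f k <= t)%nat.
  change (1 <= g k <= t)%nat in Hk. destruct (H k); lia.
Qed.

(** Each removal of the first occurrences accounts for one [2^-t] and lowers the multiplicity;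
    completeness up to [t] passes to both remaining names. *)
Lemma delta_n_name_tail (n : nat) (f : nat -> nat) (x : R) (t : nat) :
  delta_n_name n f x -> complete_up_to f t ->
  x <= lsum (name_term f) (seq 0 t) + INR n * (/ 2) ^ t.
Proof.
  revert f x. induction n as [|n IH]; intros f x Hx Ht.
  - rewrite (delta_0_name_sum f x Hx). simpl INR.
    pose proof (lsum_nonneg _ (seq 0 t) (name_term_nonneg f)). lra.
  - destruct (delta_n_name_stale n f x Hx) as (y & z & Hy & Hz & <-).
    assert (H1 := injective_name_tail (fresh f) y t (fresh_injective f)).
    assert (H2 := IH (stale f) z Hz).
    rewrite (lsum_plus (name_term f) (name_term (fresh f)) (name_term (stale f))).
    + rewrite S_INR.
      assert (complete_up_to (fresh f) t /\ complete_up_to (stale f) t) as [C1 C2].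
      { split; apply complete_up_to_mono with f; try assumption;
          intros k; destruct (fresh_stale f k) as [[]|[]]; auto. }
      specialize (H1 C1 (proj2 Hy)). specialize (H2 C2). lra.
    + intros k. destruct (fresh_stale f k) as [[E1 E2]|[E1 E2]].
      * rewrite (name_term_eq (fresh f) f k k E1), (name_term_0 (stale f) k E2). ring.
      * rewrite (name_term_eq (stale f) f k k E2), (name_term_0 (fresh f) k E1). ring.
Qed.

(** ** Strongly c.e. sums and computable names *)

(** Elements are shifted by one to keep [0] for absent terms, and repetitions in the enumeration are
    erased by [fresh]. *)
Lemma ce_set_name (A : Ensemble nat) : comp_enumerable A ->
  exists f, computable f /\ injective_name f /\
    forall a, Ensembles.In nat A a <-> exists k, f k = S a.
Proof.
  intros [Hno|(g & Hg & HA)].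
  - exists (fun _ => 0%nat). split; [apply computable_const|split].
    + intros j k _ H. contradiction.
    + intros a. split; [intros Ha; destruct (Hno a Ha)|intros [_ [=]]].
  - exists (fresh (fun k => S (g k))). split; [|split].
    + apply computable_recursive, recursive_fresh, computable_recursive.
      apply (computable_comp g S Hg computable_S).
    + apply fresh_injective.
    + intros a. rewrite fresh_range, HA.
      split; intros [k Hk]; exists k; congruence.
Qed.

Lemma range_ce (f : nat -> nat) : computable f ->
  comp_enumerable (fun a => exists k, f k = S a).
Proof.
  intros Hf.
  destruct (excluded_middle_informative (exists a k, f k = S a)) as [(a & k0 & E0)|Hno].
  (* The enumeration must be total, so stages with [f k = 0] output the known element [a]. *)
  - right. exists (fun k => if (f k =? 0)%nat then a else Nat.pred (f k)). split.
    + apply computable_recursive. apply computable_recursive in Hf.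
      apply (recursive_if _ (fun _ v => (f (Vector.hd v) =? 0)%nat)
               (fun _ _ => a) (fun _ v => Nat.pred (f (Vector.hd v)))).
      * apply decidable_eqb; [exact Hf|apply recursive_const].
      * apply recursive_const.
      * apply recursive_pred, Hf.
    + intros b. split; intros [k Ek].
      * exists k. rewrite Ek. reflexivity.
      * destruct (Nat.eqb_spec (f k) 0) as [E|E].
        -- exists k0. congruence.
        -- exists k. lia.
  - left. intros a [k Ek]. apply Hno. exists a, k. exact Ek.
Qed.

Lemma injective_name_strongly_left_computable (f : nat -> nat) (x : R) :
  computable f -> injective_name f -> delta_name f x -> strongly_left_computable x.
Proof.
  intros Hf Hinj [Hx0 Hx]. split.
  - split; [assumption|].
    (* Every name is complete up to [0], and the tail estimate there gives [x <= 1]. *)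
    assert (H : x <= lsum (name_term f) (seq 0 0) + (/ 2) ^ 0).
    { apply injective_name_tail; try assumption. intros k Hk.
      change (1 <= f k <= 0)%nat in Hk. lia. }
    unfold lsum in H. simpl in H. lra.
  - exists (fun a => exists k, f k = S a). split; [apply range_ce, Hf|].
    apply (name_series_set f); [assumption|intros a; reflexivity|assumption].
Qed.

(** Induction on the summands: interleaving with an injective name of one more set raises the
    multiplicity by at most one. *)
Lemma n_strongly_ce_name (n : nat) (x : R) : n_strongly_ce n x ->
  exists f, computable f /\ delta_n_name n f x.
Proof.
  intros (l & <- & Hl & ->). induction Hl as [|x l Hx Hl (g & Hg & Hgn)]; simpl.
  - exists (fun _ => 0%nat). split; [apply computable_const|split].
    + split; [lra|]. apply is_series_lsum.
      apply is_lim_seq_ext with (fun _ => 0); [|apply is_lim_seq_const].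
      intros n. unfold lsum. induction (seq 0 n) as [|k s IH]; [reflexivity|].
      simpl. rewrite <- IH. unfold name_term. ring.
    + apply multiplicity_le_NoDup. intros i s _ Hs.
      destruct s as [|k s]; [simpl; lia|]. discriminate (Hs k (or_introl eq_refl)).
  - destruct Hx as (Hx & A & HA & Hsum).
    destruct (ce_set_name A HA) as (f & Hf & Hinj & Hrange).
    exists (interleave f g). split; [|split].
    + apply computable_recursive, recursive_interleave; apply computable_recursive; assumption.
    + destruct Hgn as [[H0 Hgs] _]. split; [lra|].
      apply name_series_interleave; [|assumption].
      apply (name_series_set f A x Hinj Hrange), Hsum.
    + apply (interleave_multiplicity _ f g Hinj (proj2 Hgn)).
Qed.

(** The converse passage: [fresh f] yields one strongly left-computable summand, and [stale f] the
    other [n] by induction. *)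
Lemma name_n_strongly_ce (n : nat) (f : nat -> nat) (x : R) :
  computable f -> delta_n_name n f x -> n_strongly_ce n x.
Proof.
  revert f x. induction n as [|n IH]; intros f x Hf Hx.
  - exists []. repeat split; [constructor|]. apply (delta_0_name_sum f x Hx).
  - destruct (delta_n_name_stale n f x Hx) as (y & z & Hy & Hz & <-).
    destruct (IH (stale f) z) as (l & Hlen & Hl & ->); [|assumption|].
    { apply computable_recursive, recursive_stale, computable_recursive, Hf. }
    exists (y :: l). split; [simpl; congruence|split; [|reflexivity]].
    constructor; [|assumption].
    apply (injective_name_strongly_left_computable (fresh f));
      [|apply fresh_injective|assumption].
    apply computable_recursive, recursive_fresh, computable_recursive, Hf.
Qed.

(** ** Regaining approximations *)

Lemma numerator_exponent (f : nat -> nat) (n : nat) :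
  INR (numerator f n) / 2 ^ exponent f n = lsum (name_term f) (seq 0 n).
Proof.
  induction n as [|n IH]; [unfold lsum; simpl; field|].
  rewrite lsum_seq_S, <- IH.
  change (exponent f (S n)) with (exponent f n + f n)%nat.
  change (numerator f (S n)) with
    (if (f n =? 0)%nat then numerator f n
     else (numerator f n * 2 ^ f n + 2 ^ exponent f n)%nat).
  pose proof (pow_lt 2 (exponent f n) ltac:(lra)).
  pose proof (pow_lt 2 (f n) ltac:(lra)).
  rewrite pow_add. destruct (Nat.eqb_spec (f n) 0) as [E|E].
  - rewrite name_term_0, E by assumption. simpl. field. lra.
  - unfold name_term. destruct (f n) as [|a] eqn:Ea; [lia|].
    rewrite plus_INR, mult_INR, !pow_INR, pow_inv.
    change (INR 2) with 2. field. lra.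
Qed.

(** The common denominator is the product of all [2^(f k)], left unreduced. [Nat.pred] compensates
    for the successor in [Pos.of_succ_nat], the form required by [computable_Qseq]. *)
Definition partial_sum (f : nat -> nat) (n : nat) : Q :=
  Z.of_nat (numerator f n) # Pos.of_succ_nat (Nat.pred (2 ^ exponent f n)).

Lemma partial_sum_eq (f : nat -> nat) (n : nat) :
  Q2R (partial_sum f n) = lsum (name_term f) (seq 0 n).
Proof.
  rewrite <- numerator_exponent. unfold partial_sum, Q2R, Rdiv. simpl Qnum.
  rewrite <- INR_IZR_INZ. f_equal. f_equal. simpl Qden.
  pose proof (Nat.pow_nonzero 2 (exponent f n) ltac:(lia)).
  replace (Z.pos (Pos.of_succ_nat (Nat.pred (2 ^ exponent f n))))
    with (Z.of_nat (2 ^ exponent f n)) by lia.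
  rewrite <- INR_IZR_INZ, pow_INR. reflexivity.
Qed.

Lemma computable_partial_sum (f : nat -> nat) (c : nat) :
  computable f -> computable_Qseq (fun n => partial_sum f (n + c)).
Proof.
  intros Hf. apply computable_recursive in Hf.
  (* Partial sums are non-negative, so the subtracted part of the numerator is [0]. *)
  exists (fun n => numerator f (n + c)), (fun _ => 0%nat),
    (fun n => Nat.pred (2 ^ exponent f (n + c))).
  assert (Hc : computable (fun n => n + c)%nat).
  { apply computable_recursive, recursive_add;
      [apply recursive_hd|apply recursive_const]. }
  split; [|split; [apply computable_const|split]].
  - apply (computable_comp _ (numerator f) Hc), computable_recursive.
    apply recursive_numerator, Hf.
  - apply (computable_comp _ (fun n => Nat.pred (2 ^ exponent f n)) Hc).
    apply computable_recursive, recursive_pred, recursive_pow2.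
    apply (recursive_exponent _ _ Hf).
  - intros n. rewrite Z.sub_0_r. reflexivity.
Qed.

Lemma delta_n_name_regaining (n : nat) (f : nat -> nat) (x : R) :
  computable f -> delta_n_name n f x -> infinitely_many (complete_up_to f) ->
  regainingly_approximable x.
Proof.
  intros Hf Hx Hinf. exists (fun k => partial_sum f (k + n)).
  split; [apply computable_partial_sum, Hf|split; [|split]].
  - intros k. apply Rle_Qle. rewrite !partial_sum_eq.
    change (S k + n)%nat with (S (k + n)). rewrite lsum_seq_S.
    pose proof (name_term_nonneg f (k + n)). lra.
  - apply is_lim_seq_ext with (fun k => lsum (name_term f) (seq 0 (k + n))).
    + intros k. symmetry. apply partial_sum_eq.
    + apply (is_lim_seq_incr_n (fun k => lsum (name_term f) (seq 0 k))).
      apply is_series_lsum. apply Hx.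
  - intros N. destruct (Hinf (N + n)%nat) as (t & Ht & Hc).
    (* The shifted sequence reaches the partial sum of length [t] at index [t - n]; asking for
       [t >= N + n] keeps this index at least [N]. *)
    exists (t - n)%nat. split; [lia|]. rewrite partial_sum_eq.
    replace (t - n + n)%nat with t by lia.
    pose proof (delta_n_name_tail n f x t Hx Hc) as H.
    assert (INR n * (/ 2) ^ t < (/ 2) ^ (t - n)); [|lra].
    replace t with (n + (t - n))%nat at 1 by lia. rewrite pow_add, <- Rmult_assoc.
    rewrite <- (Rmult_1_l ((/ 2) ^ (t - n))) at 2.
    apply Rmult_lt_compat_r; [apply half_pow_pos|].
    (* What remains is [n * 2^-n < 1], that is, [n < 2^n]. *)
    rewrite pow_inv. apply Rmult_lt_reg_r with (2 ^ n); [apply pow_lt; lra|].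
    rewrite Rmult_assoc, Rinv_l, Rmult_1_r, Rmult_1_l by (apply pow_nonzero; lra).
    change 2 with (INR 2). rewrite <- pow_INR. apply lt_INR.
    apply Nat.pow_gt_lin_r. lia.
Qed.

(** ** The splitting theorem *)

Lemma part_split (f : nat -> nat) (k : nat) :
  (part true f k = f k /\ part false f k = 0%nat) \/
  (part true f k = 0%nat /\ part false f k = f k).
Proof. unfold part. destruct Nat.even; simpl; auto. Qed.

(** Here the oracle is itself the index [i], so the program obtained does not depend on [f]. *)
Lemma computes_from_part (b : bool) :
  exists p : prog unit 1, forall f, computes_from p f (part b f).
Proof.
  destruct (recursive_part (fun (f : nat -> nat) (_ : unit) => f) b (fun f => f))
    as [p Hp].
  - exists (Query tt). intros f v. reflexivity.
  - exists p. intros f k. apply (Hp f (Vector.cons nat k 0 (Vector.nil nat))).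
Qed.

Lemma computable_part (b : bool) (f : nat -> nat) :
  computable f -> computable (part b f).
Proof.
  intros Hf. apply computable_recursive, recursive_part, computable_recursive, Hf.
Qed.

(** A computable name of multiplicity at most [n] is split; both parts remain computable with
    multiplicity at most [n], and their infinitely many completeness points make both sums
    regainingly approximable. *)
Lemma n_strongly_ce_split (n : nat) (x : R) : n_strongly_ce n x ->
  exists y z : R,
    n_strongly_ce n y /\ n_strongly_ce n z /\ y + z = x /\
    regainingly_approximable y /\ regainingly_approximable z.
Proof.
  intros Hx. destruct (n_strongly_ce_name n x Hx) as (f & Hf & Hd & Hm).
  destruct (delta_name_split f (part true f) (part false f) x (part_split f) Hd)
    as (y & z & Hy & Hz & E).
  pose proof (delta_name_finite_to_one f x Hd) as Hfin.
  assert (Hb : forall b u, delta_name (part b f) u ->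
            n_strongly_ce n u /\ regainingly_approximable u).
  { intros b u Hu.
    assert (delta_n_name n (part b f) u)
      by (split; [assumption|exact (multiplicity_le_part b n f Hm)]).
    split; [apply (name_n_strongly_ce n (part b f))|
            apply (delta_n_name_regaining n (part b f))];
      auto using computable_part, part_complete. }
  destruct (Hb true y Hy), (Hb false z Hz). exists y, z. auto.
Qed.

Theorem theorem9p5 :
  (exists pa pb : prog unit 1,
     forall (fg : nat -> nat) (gamma : R), delta_name fg gamma ->
     exists (fa fb : nat -> nat) (alpha beta : R),
       computes_from pa fg fa /\ computes_from pb fg fb /\
       delta_name fa alpha /\ delta_name fb beta /\
       alpha + beta = gamma /\
       infinitely_many (complete_up_to fa) /\
       infinitely_many (complete_up_to fb) /\
       (forall n : nat, delta_n_name n fg gamma ->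
          delta_n_name n fa alpha /\ delta_n_name n fb beta)) /\
  (forall (n : nat) (gamma : R), n_strongly_ce n gamma ->
     exists alpha beta : R,
       n_strongly_ce n alpha /\ n_strongly_ce n beta /\ alpha + beta = gamma /\
       regainingly_approximable alpha /\ regainingly_approximable beta) /\
  (forall gamma : R, regular gamma ->
     exists alpha beta : R,
       regular alpha /\ regular beta /\ alpha + beta = gamma /\
       regainingly_approximable alpha /\ regainingly_approximable beta).
Proof.
  split; [|split].
  - destruct (computes_from_part true) as [pa Hpa].
    destruct (computes_from_part false) as [pb Hpb].
    exists pa, pb. intros f x Hx.
    destruct (delta_name_split f (part true f) (part false f) x (part_split f) Hx)
      as (y & z & Hy & Hz & E).
    pose proof (delta_name_finite_to_one f x Hx) as Hfin.
    exists (part true f), (part false f), y, z.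
    repeat match goal with |- _ /\ _ => split end; auto using part_complete.
    intros n [_ Hm]. split; (split; [assumption|]); exact (multiplicity_le_part _ n f Hm).
  - exact n_strongly_ce_split.
  - intros x [n Hn].
    destruct (n_strongly_ce_split n x Hn) as (y & z & Hy & Hz & H).
    exists y, z. split; [exists n; exact Hy|split; [exists n; exact Hz|exact H]].
Qed.
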